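(* Let $\mathbb{J}$ be a steady $\mathbb{F}_1$-composable class of filters containing $\mathbb{F}_1$ and let $\star$, $\square$ and $\bigtriangledown$ be $\times$-compatible relations. Let $X$ be a topological space ($Y$ below ranges over topological spaces, and $X\times Y$ carries the product topology). (1) The following are equivalent: (a) $X$ is $\ker(\mathbb{J}^\star)$-based; (b) $X\times Y$ is $\ker(\mathbb{J}^\star)$-based for every $\ker(\mathbb{J}^{\star\star})$-based $Y$; (c) $X\times Y$ is $\mathbb{J}^\star$-based for every $\mathbb{J}$-based $Y$; (d) $X\times Y$ is $\mathbb{F}_1^\star$-based for every $\mathbb{J}$-based $Y$. (2) If $\mathbb{J}^\star$ is $\mathbb{F}_1$-composable and contains $\mathbb{F}_1$, then the following are equivalent: (a) $X$ is $\ker(\mathbb{J}^{\star\square})$-based; (b) $X\times Y$ is $\ker\big((\ker(\mathbb{J}^{\star\star}))^\square\big)$-based for every $\mathbb{J}^\star$-based $Y$; (c) $X\times Y$ is $\mathbb{J}^\square$-based for every $\mathbb{J}^\star$-based $Y$; (d) $X\times Y$ is $\mathbb{F}_1^\square$-based for every $\mathbb{J}^\star$-based $Y$. (3) If $\mathbb{J}^\star$ is $\mathbb{F}_1$-composable and contains $\mathbb{F}_1$, and if $X$ is $\ker(\mathbb{J}^{\bigtriangledown\square})$-based, then $X\times Y$ is $\ker(\mathbb{J}^{\star\square})$-based for every $\ker(\mathbb{J}^{\star\bigtriangledown})$-based $Y$.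
   Context: Filters are proper. $\mathbb{F}(X)$ is the set of filters on $X$. A class $\mathbb{J}$ of filters prescribes for each set $X$ a subset $\mathbb{J}(X)\subseteq\mathbb{F}(X)$. $\mathbb{F}_1$ is the class of principal filters $A^\uparrow=\{B\subseteq X: A\subseteq B\}$ ($A\neq\varnothing$); a set is identified with its principal filter. A topological space is $\mathbb{J}$-based if all its neighborhood filters are $\mathbb{J}$-filters. Two families of sets mesh, $\mathcal{F}\#\mathcal{G}$, if $F\cap G\ne\varnothing$ for all $F\in\mathcal{F}$, $G\in\mathcal{G}$. If filters $\mathcal{F},\mathcal{G}$ mesh, $\mathcal{F}\vee\mathcal{G}$ is the filter generated by the sets $F\cap G$. $\mathcal{F}\times\mathcal{G}$ is the filter generated by the sets $F\times G$. For a filter $\mathcal{F}$ on $X$ and a filter $\mathcal{H}$ on $X\times Y$ with $\mathcal{H}\#(\mathcal{F}\times Y)$, $\mathcal{H}\mathcal{F}$ is the filter on $Y$ generated by the sets $HF=\{y:\exists x\in F,\ (x,y)\in H\}$, $H\in\mathcal{H}$, $F\in\mathcal{F}$ (for a set $A\subseteq X\times Y$, $A\mathcal{F}=A^\uparrow\mathcal{F}$). A symmetric relation $\star$ on $\mathbb{F}(X)$ (given for every set $X$) is $\vee$-compatible if $\mathcal{F}\star\mathcal{G}$ whenever $\mathcal{F},\mathcal{G}$ do not mesh, and $\mathcal{F}\star(\mathcal{G}\vee\mathcal{H})\Rightarrow(\mathcal{F}\vee\mathcal{H})\star\mathcal{G}$ whenever $\mathcal{G}\#\mathcal{F}$ and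 $\mathcal{F}\#\mathcal{H}$ (and $\mathcal{G}\vee\mathcal{H}$ is defined, i.e. $\mathcal{G}\#\mathcal{H}$). A $\vee$-compatible relation is $\times$-compatible if, for all sets $X,Y$, filters $\mathcal{F}$ on $X$, $\mathcal{G}$ on $Y$ and $\mathcal{A}$ on $X\times Y$ (with $\mathcal{A}\#(\mathcal{F}\times Y)$), $(\mathcal{F}\times\mathcal{G})\star\mathcal{A}\Rightarrow\mathcal{G}\star\mathcal{A}\mathcal{F}$. The polar of a class is $\mathbb{J}^\star(X)=\{\mathcal{F}\in\mathbb{F}(X): \mathcal{F}\star\mathcal{G}\text{ for all }\mathcal{G}\in\mathbb{J}(X)\}$; iterated polars are read left to right: $\mathbb{J}^{\star\square}=(\mathbb{J}^\star)^\square$. A class $\mathbb{J}$ is steady if $\mathcal{F}\vee\mathcal{H}\in\mathbb{J}(X)$ whenever $\mathcal{F},\mathcal{H}\in\mathbb{J}(X)$ mesh. It is $\mathbb{F}_1$-composable if $A\mathcal{F}\in\mathbb{J}(Y)$ for all sets $X,Y$, all $\mathcal{F}\in\mathbb{J}(X)$ and all $A\subseteq X\times Y$ with $A\#(\mathcal{F}\times Y)$. The kernel $\ker(\mathbb{J})$ is the class of filters $\mathcal{F}$ (on a set $X$) such that $A\mathcal{F}\in\mathbb{J}(Y)$ for every set $Y$ and every $A\subseteq X\times Y$ with $A\#(\mathcal{F}\times Y)$. *)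

(* Defs.v *)
From HB Require Import structures.
From mathcomp Require Import all_boot all_classical.
From mathcomp Require Import topology.

Set Implicit Arguments.
Unset Strict Implicit.
Unset Printing Implicit Defensive.

Local Open Scope classical_set_scope.

(* Filters on X are the terms F : set_system X with ProperFilter F. F x G is
   the library's filter_prod F G, F # G is F `#` G, and the principal filter
   of a set A is globally A. *)

Record class_of_filters := ClassOfFilters {
  in_class :> forall X : Type, set (set_system X) ;
  in_class_proper :
    forall (X : Type) (F : set_system X), in_class F -> ProperFilter F }.

(* Values on set systems that are not proper filters are irrelevant: every
   condition on a relation below only involves proper filters. *)
Definition filter_relation :=
  forall X : Type, set_system X -> set_system X -> Prop.

Definition class_sub (J K : class_of_filters) : Prop :=
  forall (X : Type) (F : set_system X), J X F -> K X F.

Lemma principal_proper (X : Type) (F : set_system X) :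
  (exists2 A : set X, A !=set0 & F = globally A) -> ProperFilter F.
Proof. by move=> [A [a Aa] ->]; exact: globally_properfilter Aa. Qed.

Definition principal_class : class_of_filters :=
  @ClassOfFilters (fun X F => exists2 A : set X, A !=set0 & F = globally A)
    principal_proper.

Definition filter_join (X : Type) (F G : set_system X) : set_system X :=
  filter_from [set P : set X * set X | F P.1 /\ G P.2]
    (fun P => P.1 `&` P.2).

Definition rel_image (X Y : Type) (H : set (X * Y)) (A : set X) : set Y :=
  [set y | exists2 x, A x & H (x, y)].

Definition filter_image (X Y : Type) (H : set_system (X * Y))
    (F : set_system X) : set_system Y :=
  filter_from [set P : set (X * Y) * set X | H P.1 /\ F P.2]
    (fun P => rel_image P.1 P.2).

Definition cylinder (X Y : Type) (F : set_system X) : set_system (X * Y) :=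
  filter_prod F (globally [set: Y]).
Arguments cylinder {X} Y F.

Definition join_compatible (star : filter_relation) : Prop :=
  [/\ forall (X : Type) (F G : set_system X),
        ProperFilter F -> ProperFilter G -> star X F G -> star X G F,
      forall (X : Type) (F G : set_system X),
        ProperFilter F -> ProperFilter G -> ~ F `#` G -> star X F G
    & forall (X : Type) (F G H : set_system X),
        ProperFilter F -> ProperFilter G -> ProperFilter H ->
        G `#` F -> F `#` H -> G `#` H ->
        star X F (filter_join G H) -> star X (filter_join F H) G].

Definition prod_compatible (star : filter_relation) : Prop :=
  join_compatible star /\
  forall (X Y : Type) (F : set_system X) (G : set_system Y)
      (A : set_system (X * Y)),
    ProperFilter F -> ProperFilter G -> ProperFilter A ->
    A `#` cylinder Y F ->
    star (X * Y)%type (filter_prod F G) A -> star Y G (filter_image A F).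

Definition polar (J : class_of_filters) (star : filter_relation) : class_of_filters :=
  @ClassOfFilters
    (fun X F => ProperFilter F /\
       forall G : set_system X, J X G -> star X F G)
    (fun X F FJ => proj1 FJ).

Definition steady (J : class_of_filters) : Prop :=
  forall (X : Type) (F H : set_system X),
    J X F -> J X H -> F `#` H -> J X (filter_join F H).

Definition composable1 (J : class_of_filters) : Prop :=
  forall (X Y : Type) (F : set_system X) (A : set (X * Y)),
    J X F -> globally A `#` cylinder Y F ->
    J Y (filter_image (globally A) F).

Definition ker (J : class_of_filters) : class_of_filters :=
  @ClassOfFilters
    (fun X F => ProperFilter F /\
       forall (Y : Type) (A : set (X * Y)),
         globally A `#` cylinder Y F -> J Y (filter_image (globally A) F))
    (fun X F FJ => proj1 FJ).

Definition based (J : class_of_filters) (X : topologicalType) : Prop :=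
  forall x : X, J X (nbhs x).

(* Main.v *)
From HB Require Import structures.
From mathcomp Require Import all_boot all_classical.
From mathcomp Require Import topology.
Require Import Defs.

Set Implicit Arguments.
Unset Strict Implicit.
Unset Printing Implicit Defensive.

Local Open Scope classical_set_scope.

(** Write [F # G] for meshing, [F v G] for joins and [J*] for the polar of [J].
    Since [nbhs (x, y)] is [filter_prod (nbhs x) (nbhs y)], every implication
    that leads to products is a statement on products of filters, and all of
    them come from one lemma, [ker_polar_prod]: if [F] is in [ker L*] and
    [filter_prod G H] is in [L] for every [H] in [M], then [filter_prod F G] is
    in [ker M*]. Indeed the image of [filter_prod F G] under a relation [A] is
    [K G], where [K] is the image of [F] under [A] read as a relation from [X]
    to [Y * Z]; the hypothesis on [F] relates [K] to [filter_prod G H], and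
    product compatibility turns this into a relation between [H] and [K G].

    What remains is to show that [filter_prod G H] is in a polar. It is the join
    of the cylinders of [G] and [H], so [polar_prod] moves the cylinder of [H] to
    the other side by join compatibility: the cylinder of [G] has to be related
    to [M v H], with [M] in the class under test. Such joins stay in [J*] when
    one of the two filters is in [J*] and the other one in [J], because [J] is
    steady ([polar_join]).

    The inclusions [J <= ker J**] and [ker J* <= J*], and the fact that polars
    reverse inclusions, give the middle implications of both cycles. To close
    the cycles ([based_ker_polar_of_prod]), each filter [H] of the class is
    turned into a neighborhood filter of a space [cone] whose neighborhood
    filters are all in the class. Testing [X * cone] against the principal
    filter of a copy of [A] then relates the image of [nbhs x] under [A] to
    [H]. *)

(** * Joins, products and images of filters *)

Lemma filter_join_proper (X : Type) (F G : set_system X) :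
  ProperFilter F -> ProperFilter G -> F `#` G -> ProperFilter (filter_join F G).
Proof.
move=> PF PG FG; apply: filter_from_proper => [|[P Q] [FP GQ]]; last exact: FG.
apply: filter_from_filter; first by exists (setT, setT); split; exact: filterT.
move=> [P Q] [P' Q'] [/= FP GQ] [/= FP' GQ'].
exists (P `&` P', Q `&` Q'); first by split; exact: filterI.
by move=> x [[Px P'x] [Qx Q'x]].
Qed.

Lemma filter_joinC (X : Type) (F G : set_system X) :
  filter_join F G = filter_join G F.
Proof.
rewrite eqEsubset; split=> S [[P Q] [/= FP GQ] PQS].
  by exists (Q, P); [split | rewrite setIC].
by exists (Q, P); [split | rewrite setIC].
Qed.

Lemma filter_image_proper (X Y : Type) (H : set_system (X * Y))
    (F : set_system X) :
  ProperFilter H -> ProperFilter F -> H `#` cylinder Y F ->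
  ProperFilter (filter_image H F).
Proof.
move=> PH PF HF; apply: filter_from_proper => [|[B P] [/= HB FP]].
  apply: filter_from_filter; first by exists (setT, setT); split; exact: filterT.
  move=> [B P] [B' P'] [/= HB FP] [/= HB' FP'].
  exists (B `&` B', P `&` P'); first by split; exact: filterI.
  by move=> y [x [Px P'x] [Bxy B'xy]]; split; exists x.
have cylP : cylinder Y F (P `*` setT) by exists (P, setT).
by have [[x y] [Bxy [/= Px _]]] := HF _ _ HB cylP; exists y, x.
Qed.

Lemma filter_image_globallyE (X Y : Type) (A : set (X * Y)) (F : set_system X) :
  filter_image (globally A) F = filter_from F (rel_image A).
Proof.
rewrite eqEsubset; split=> S.
  move=> [[B P] [/= AB FP] BPS]; exists P => // y [x Px Axy].
  by apply: BPS; exists x => //; exact: AB.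
by move=> [P FP APS]; exists (A, P) => //; split.
Qed.

Lemma globally_meets_cylinder (X Y : Type) (A : set (X * Y))
    (F : set_system X) :
  globally A `#` cylinder Y F <-> forall P, F P -> rel_image A P !=set0.
Proof.
split=> [AF P FP|AF B C AB [[P Q] [/= FP QT] PQC]].
  have cylP : cylinder Y F (P `*` setT) by exists (P, setT).
  have [[x y] [Axy [/= Px _]]] := AF A _ (fun=> id) cylP.
  by exists y, x.
have [y [x Px Axy]] := AF _ FP.
by exists (x, y); split; [exact: AB | apply: PQC; split => //; exact: QT].
Qed.

Lemma globally_set_proper (X : Type) (a : X) :
  ProperFilter (globally [set a]).
Proof. exact: (@globally_properfilter _ _ a). Qed.

Lemma globally_setT_proper (X : Type) (a : X) :
  ProperFilter (globally [set: X]).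
Proof. exact: (@globally_properfilter _ _ a). Qed.

Lemma filter_prodE (X Y : Type) (F : set_system X) (G : set_system Y) :
  Filter F -> Filter G ->
  filter_prod F G =
  filter_join (cylinder Y F) (filter_prod (globally [set: X]) G).
Proof.
move=> FF FG; rewrite eqEsubset; split=> S.
  move=> [[P Q] [/= FP GQ] PQS].
  exists (P `*` setT, setT `*` Q); last by move=> [x y] [[/= Px _] [_ Qy]]; exact: PQS.
  by split; [exists (P, setT) | exists (setT, Q)].
move=> [[B C] [/= [[P T] [/= FP TT] PTB] [[T' Q] [/= TT' GQ] TQC]] BCS].
exists (P, Q) => // -[x y] [/= Px Qy]; apply: BCS; split.
  by apply: PTB; split=> //; exact: TT.
by apply: TQC; split=> //; exact: TT'.
Qed.

(** Images of product filters can be computed one factor at a time, once a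
    relation from [X * Y] to [Z] is read as a relation from [X] to [Y * Z]. *)
Lemma filter_image_prod (X Y Z : Type) (A : set (X * Y * Z))
    (F : set_system X) (G : set_system Y) :
  filter_image (globally A) (filter_prod F G) =
  filter_image
    (filter_image (globally [set p : X * (Y * Z) | A (p.1, p.2.1, p.2.2)]) F) G.
Proof.
rewrite !filter_image_globallyE eqEsubset; split=> S.
  move=> [R [[P Q] [/= FP GQ] PQR] RS].
  set A' := [set p : X * (Y * Z) | _].
  exists (rel_image A' P, Q); first by split=> //; exists P.
  move=> z [y Qy [x Px Axyz]]; apply: RS; exists (x, y) => //.
  exact: PQR.
move=> [[U Q] [/= [P FP PU] GQ] UQS].
exists (P `*` Q); first by exists (P, Q).
move=> z [[x y] [/= Px Qy] Axyz]; apply: UQS; exists y => //.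
by apply: PU; exists x.
Qed.

(** * Classes of filters *)

Lemma composable1_sub_ker (J : class_of_filters) :
  composable1 J -> class_sub J (ker J).
Proof.
move=> cJ X F JF; split; first exact: in_class_proper JF.
by move=> Y A; exact: cJ.
Qed.

(** Inverse images under a map [f] are images under the relation
    [f y = x]. *)
Lemma ker_preimage (J : class_of_filters) (X Y : Type) (f : Y -> X)
    (F : set_system X) :
  ker J X F -> (forall P, F P -> f @^-1` P !=set0) ->
  J Y (filter_from F (fun P => f @^-1` P)).
Proof.
move=> [_ kF] fF; pose A := [set p : X * Y | f p.2 = p.1].
have AE P : rel_image A P = f @^-1` P.
  rewrite eqEsubset; split=> y; first by move=> [x Px /= ->].
  by move=> Pfy; exists (f y).
have := kF _ A; rewrite filter_image_globallyE (funext AE); apply.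
by apply/globally_meets_cylinder => P FP; rewrite AE; exact: fF.
Qed.

Lemma ker_sub (J : class_of_filters) : class_sub (ker J) J.
Proof.
move=> X F kF; have PF := in_class_proper kF.
have -> : F = filter_from F (fun P => id @^-1` P).
  rewrite eqEsubset; split=> S; first by move=> FS; exists S.
  by move=> [P FP PS]; exact: filterS FP.
by apply: ker_preimage => // P FP; exact: filter_ex FP.
Qed.

Lemma ker_cylinder (J : class_of_filters) (X Y : Type) (y : Y)
    (F : set_system X) :
  ker J X F -> J (X * Y)%type (cylinder Y F).
Proof.
move=> kF; have PF := in_class_proper kF.
have -> : cylinder Y F = filter_from F (fun P => fst @^-1` P).
  rewrite eqEsubset; split=> S.
    move=> [[P T] [/= FP TT] PTS]; exists P => // -[a b] /= Pa.
    by apply: PTS; split=> //; exact: TT.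
  move=> [P FP PS]; exists (P, setT) => // -[a b] [/= Pa _]; exact: PS.
apply: ker_preimage => // P FP; have [x Px] := filter_ex FP.
by exists (x, y).
Qed.

Lemma ker_cylinder_r (J : class_of_filters) (X Y : Type) (x : X)
    (G : set_system Y) :
  ker J Y G -> J (X * Y)%type (filter_prod (globally [set: X]) G).
Proof.
move=> kG; have PG := in_class_proper kG.
have -> : filter_prod (globally [set: X]) G =
          filter_from G (fun Q => snd @^-1` Q).
  rewrite eqEsubset; split=> S.
    move=> [[T Q] [/= TT GQ] TQS]; exists Q => // -[a b] /= Qb.
    by apply: TQS; split=> //; exact: TT.
  move=> [Q GQ QS]; exists (setT, Q) => // -[a b] [/= _ Qb]; exact: QS.
apply: ker_preimage => // Q GQ; have [y Qy] := filter_ex GQ.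
by exists (x, y).
Qed.

Lemma polar_sub (J K : class_of_filters) (star : filter_relation) :
  class_sub J K -> class_sub (polar K star) (polar J star).
Proof. by move=> JK X F [PF KF]; split=> // G /JK; exact: KF. Qed.

Lemma ker_mono (J K : class_of_filters) :
  class_sub J K -> class_sub (ker J) (ker K).
Proof. by move=> JK X F [PF JF]; split=> // Y A /JF; exact: JK. Qed.

Lemma sub_bipolar (J : class_of_filters) (star : filter_relation) :
  join_compatible star -> class_sub J (polar (polar J star) star).
Proof.
move=> [starC _ _] X F JF; have PF := in_class_proper JF.
by split=> // G [PG GJ]; apply: starC => //; exact: GJ.
Qed.

Lemma sub_ker_bipolar (J : class_of_filters) (star : filter_relation) :
  join_compatible star -> composable1 J ->
  class_sub J (ker (polar (polar J star) star)).
Proof.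
move=> sJ cJ X F /(composable1_sub_ker cJ).
by apply: ker_mono; exact: sub_bipolar.
Qed.

Lemma based_sub (J K : class_of_filters) (X : topologicalType) :
  class_sub J K -> based J X -> based K X.
Proof. by move=> JK bX x; exact/JK/bX. Qed.

(** * Polars, joins and products *)

(** The exchange law of a [join_compatible] relation with a single mesh
    hypothesis: filters that do not mesh are related, and if [filter_join F H]
    meshes with [G] then so do [F] and [H]. *)
Lemma join_exchange (star : filter_relation) (X : Type)
    (F G H : set_system X) :
  join_compatible star ->
  ProperFilter F -> ProperFilter G -> ProperFilter H -> F `#` H ->
  (G `#` H -> star X F (filter_join G H)) -> star X (filter_join F H) G.
Proof.
move=> [starC starN starJ] PF PG PH FH FGH.
have PFH := filter_join_proper PF PH FH.
have [FHG|/starN] := pselect (filter_join F H `#` G); last exact.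
have GF : G `#` F.
  rewrite meetsC => P Q FP GQ; apply: FHG => //.
  by exists (P, setT); [split=> //; exact: filterT | move=> x []].
have GH : G `#` H.
  rewrite meetsC => P Q FP GQ; apply: FHG => //.
  by exists (setT, P); [split=> //; exact: filterT | move=> x []].
by apply: starJ => //; exact: FGH.
Qed.

(** Exchanging a member [G] of [J] from one side of the relation to the other
    turns a test of [filter_join F G] against [N] in [J] into a test of [F]
    against [filter_join N G], which is again in [J]. *)
Lemma polar_join (J : class_of_filters) (star : filter_relation) (X : Type)
    (F G : set_system X) :
  join_compatible star -> steady J ->
  polar J star X F -> J X G -> F `#` G -> polar J star X (filter_join F G).
Proof.
move=> sJ stJ [PF FJ] JG FG; have PG := in_class_proper JG.
split=> [|N JN]; first exact: filter_join_proper.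
apply: join_exchange => //; first exact: in_class_proper JN.
by move=> NG; apply: FJ; exact: stJ.
Qed.

(** [filter_prod F G] is the join of the cylinders of [F] and [G]. Exchanging the
    latter reduces the test of [filter_prod F G] against [M] to a test of the
    cylinder of [F], which is in the polar of [K] as [F] is in its kernel. *)
Lemma polar_prod (J K : class_of_filters) (star : filter_relation)
    (X Y : Type) (F : set_system X) (G : set_system Y) :
  join_compatible star -> ker (polar K star) X F -> ProperFilter G ->
  (forall M : set_system (X * Y), J _ M ->
     M `#` filter_prod (globally [set: X]) G ->
     K _ (filter_join M (filter_prod (globally [set: X]) G))) ->
  polar J star (X * Y)%type (filter_prod F G).
Proof.
move=> sJ kF PG JK; have PF := in_class_proper kF.
have [x _] := filter_ex (@filterT _ F _); have [y _] := filter_ex (@filterT _ G _).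
have PT := globally_setT_proper x.
have [PFc FcK] := ker_cylinder y kF.
split=> [|M JM]; first exact: filter_prod_proper.
rewrite filter_prodE; apply: join_exchange => //.
- exact: in_class_proper JM.
- move=> B C [[P T] [/= FP TT] PTB] [[T' Q] [/= TT' GQ] TQC].
  have [a Pa] := filter_ex FP; have [b Qb] := filter_ex GQ.
  exists (a, b); split; [apply: PTB | apply: TQC]; split=> //.
  + exact: TT.
  + exact: TT'.
- by move=> MG; apply: FcK; exact: JK.
Qed.

(** With [K := filter_image A' F], where [A'] is [A] read as a relation from
    [X] to [Y * Z], the image of [filter_prod F G] under [A] is
    [filter_image K G].  By [prod_compatible] it is related to [H] as soon as
    [filter_prod G H] is related to [K]; the kernel hypothesis on [F] puts [K]
    in the polar of [L], and [filter_prod G H] is in [L]. *)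
Lemma ker_polar_prod (L M : class_of_filters) (star : filter_relation)
    (X Y : Type) (F : set_system X) (G : set_system Y) :
  prod_compatible star -> ker (polar L star) X F -> ProperFilter G ->
  (forall (Z : Type) (H : set_system Z), M Z H ->
     L (Y * Z)%type (filter_prod G H)) ->
  ker (polar M star) (X * Y)%type (filter_prod F G).
Proof.
move=> [[starC _ _] starP] [PF kF] PG GL.
split=> [|Z A AFG]; first exact: filter_prod_proper.
have Ane P Q : F P -> G Q -> rel_image A (P `*` Q) !=set0.
  move=> FP GQ; move/globally_meets_cylinder: AFG; apply.
  by exists (P, Q).
pose A' := [set p : X * (Y * Z) | A (p.1, p.2.1, p.2.2)].
have A'F : globally A' `#` cylinder (Y * Z)%type F.
  apply/globally_meets_cylinder => P FP.
  have [z [[x y] [/= Px _] Axyz]] := Ane P setT FP filterT.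
  by exists (y, z), x.
have [PK KL] := kF _ _ A'F.
have KG : filter_image (globally A') F `#` cylinder Z G.
  move=> U C; rewrite filter_image_globallyE.
  move=> [P FP PU] [[Q T] [/= GQ TT] QTC].
  have [z [[x y] [/= Px Qy] Axyz]] := Ane P Q FP GQ.
  exists (y, z); split; first by apply: PU; exists x.
  by apply: QTC; split=> //; exact: TT.
rewrite filter_image_prod -/A'; split; first exact: filter_image_proper.
move=> H MH; have LGH := GL _ _ MH.
have PH := in_class_proper MH; have PGH := in_class_proper LGH.
apply: (starC) => //; first exact: filter_image_proper.
by apply: starP => //; apply: starC => //; exact: KL.
Qed.

Lemma ker_polar_prod_bipolar (J : class_of_filters) (star : filter_relation)
    (X Y : Type) (F : set_system X) (G : set_system Y) :
  steady J -> composable1 J -> prod_compatible star ->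
  ker (polar J star) X F -> ker (polar (polar J star) star) Y G ->
  ker (polar J star) (X * Y)%type (filter_prod F G).
Proof.
move=> stJ cJ pstar kF kG; have sJ := pstar.1.
have PG := in_class_proper kG; have [y _] := filter_ex (@filterT _ G _).
apply: (@ker_polar_prod (polar (polar J star) star)) => //.
  by apply: ker_mono kF; exact: sub_bipolar.
move=> Z H JH; apply: (@polar_prod _ (polar J star)) => //.
  exact: in_class_proper JH.
move=> M JM MH; apply: polar_join => //.
by apply: ker_cylinder_r => //; exact: composable1_sub_ker.
Qed.

(** The roles in [polar_join] are exchanged with respect to
    [ker_polar_prod_bipolar]: the test filter is in [J] and the cylinder of [H]
    is in the polar. *)
Lemma polar_prod_polar (J : class_of_filters) (star nabla : filter_relation)
    (X Y : Type) (G : set_system X) (H : set_system Y) :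
  steady J -> composable1 (polar J star) ->
  join_compatible star -> join_compatible nabla ->
  ker (polar (polar J star) nabla) X G -> polar J star Y H ->
  polar J nabla (X * Y)%type (filter_prod G H).
Proof.
move=> stJ cJs sJ nJ kG JsH.
have PG := in_class_proper kG; have [x _] := filter_ex (@filterT _ G _).
apply: (@polar_prod _ (polar J star)) => //; first exact: in_class_proper JsH.
move=> M JM MH; rewrite filter_joinC; apply: polar_join => //.
  by apply: ker_cylinder_r => //; exact: composable1_sub_ker.
by rewrite meetsC.
Qed.

Lemma based_prod (J K L : class_of_filters) (X Y : topologicalType) :
  (forall (F : set_system X) (G : set_system Y),
     J X F -> K Y G -> L (X * Y)%type (filter_prod F G)) ->
  based J X -> based K Y -> based L (X * Y)%type.
Proof. by move=> JKL bX bY [x y]; exact: JKL. Qed.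

(** * A test space for a given filter *)

(** A topological form of a filter [H] on [Z]: the points [(false, z)] are
    isolated and trace a copy of [Z], to which each point [(true, z)] is
    attached with the trace [H] of its neighborhoods. The first component is a
    Boolean, rather than [Z] being extended by a single point, because
    [prod_compatible] relations are only known to pass from a product to its
    second factor and not along bijections. *)
Definition cone (Z : Type) (H : set_system Z) (FH : Filter H) : Type :=
  (bool * Z)%type.

Section Cone.
Variables (Z : Type) (H : set_system Z) (FH : Filter H).

Definition cone_nbhs (p : cone FH) : set_system (cone FH) :=
  [set B | B p /\ (p.1 -> H [set z | B (false, z)])].

Lemma cone_nbhs_filter (p : cone FH) : ProperFilter (cone_nbhs p).
Proof.
split; first by move=> [].
split.
- by split=> // _; exact: filterT.
- by move=> P Q [Pp HP] [Qp HQ]; split=> // pT; apply: filterI; auto.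
- move=> P Q PQ [Pp HP]; split; first exact: PQ.
  by move=> /HP; apply: filterS => z; exact: PQ.
Qed.

Lemma cone_nbhs_singleton (p : cone FH) (B : set (cone FH)) :
  cone_nbhs p B -> B p.
Proof. by case. Qed.

Lemma cone_nbhs_nbhs (p : cone FH) (B : set (cone FH)) :
  cone_nbhs p B -> cone_nbhs p (cone_nbhs^~ B).
Proof.
move=> pB; split=> //; case: pB => _ HB /HB; apply: filterS => z Bz.
by split.
Qed.

HB.instance Definition _ := gen_eqMixin (cone FH).
HB.instance Definition _ := gen_choiceMixin (cone FH).
HB.instance Definition _ := hasNbhs.Build (cone FH) cone_nbhs.
HB.instance Definition _ := Nbhs_isNbhsTopological.Build (cone FH)
  cone_nbhs_filter cone_nbhs_singleton cone_nbhs_nbhs.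

(** The neighborhood filter of [(true, z)] is the image of [H] under the
    relation that sends each [z'] to both [(false, z')] and [(true, z)]. *)
Lemma based_cone (J : class_of_filters) :
  composable1 J -> class_sub principal_class J -> J Z H -> based J (cone FH).
Proof.
move=> cJ pJ JH [[] z]; last first.
  apply: pJ; exists [set (false, z)]; first by exists (false, z).
  rewrite eqEsubset; split=> S; first by move=> [Sz _] _ ->.
  by move=> zS; split=> //; exact: zS.
have PH := in_class_proper JH.
pose A := [set p : Z * cone FH | p.2 = (false, p.1) \/ p.2 = (true, z)].
have <- : filter_image (globally A) H = nbhs ((true, z) : cone FH).
  rewrite filter_image_globallyE eqEsubset; split=> S.
    move=> [P HP APS]; split.
      by have [z' Pz'] := filter_ex HP; apply: APS; exists z' => //; right.
    by move=> _; apply: filterS HP => z' Pz'; apply: APS; exists z' => //; left.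
  move=> [Sz /(_ isT) HS]; exists [set z' | S (false, z')] => //.
  by move=> y [z' Sz' [/= ->|/= ->]].
apply: cJ => //; apply/globally_meets_cylinder => P HP.
by have [z' Pz'] := filter_ex HP; exists (true, z), z' => //; right.
Qed.

End Cone.

(** * Recovering the kernel of a polar from products *)

(** Relatedness passes from a slice of a product to the factor: the slice of
    [G] over [w] is carried back to [G] by [filter_image _ (globally [set w])]. *)
Lemma star_slice (star : filter_relation) (W Z : Type) (w : W)
    (F G : set_system Z) :
  prod_compatible star -> ProperFilter F -> ProperFilter G ->
  star (W * Z)%type (filter_prod (globally [set w]) F)
                    (filter_prod (globally [set w]) G) ->
  star Z F G.
Proof.
move=> [_ starP] PF PG sFG; have Pw := globally_set_proper w.
have -> : G = filter_image (filter_prod (globally [set w]) G) (globally [set w]).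
  rewrite eqEsubset; split=> S.
    move=> GS; exists ([set w] `*` S, [set w]).
      by split=> //=; exists ([set w], S) => //; split.
    by move=> z [_ _ [/= _ Sz]].
  move=> [[B T] [/= [[T' Q] [/= wT' GQ] TQB] wT] BTS].
  apply: filterS GQ => z Qz; apply: BTS; exists w; first exact: wT.
  by apply: TQB; split=> //; exact: wT'.
apply: starP => // B C [[T Q] [/= wT GQ] TQB] [[T' Q'] [/= wT' TQ'] TQC].
have [z Qz] := filter_ex GQ; exists (w, z); split.
  by apply: TQB; split=> //; exact: wT.
by apply: TQC; split; [exact: wT' | exact: TQ'].
Qed.

(** To relate [H] in [L] to the image [K] of [nbhs x] under [A], take the
    product of [X] with the cone over [H]. Testing the neighborhood filter of
    [(x, (true, z))] against the copy of [A] over the isolated points relates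
    the neighborhoods of [(true, z)] to the copy of [K]; exchanging the set of
    isolated points replaces these neighborhoods by the copy of [H]. *)
Lemma based_ker_polar_of_prod (L : class_of_filters) (star : filter_relation)
    (X : topologicalType) :
  prod_compatible star -> composable1 L -> class_sub principal_class L ->
  (forall Y : topologicalType, based L Y ->
     based (polar principal_class star) (X * Y)%type) ->
  based (ker (polar L star)) X.
Proof.
move=> pstar cL pL bXY x; have [sJ starP] := pstar; have [starC _ starJ] := sJ.
have Px : ProperFilter (nbhs x) by exact: nbhs_pfilter.
split=> // Z A AF; have PA : ProperFilter (globally A).
  have [z [a _ Aaz]] := (globally_meets_cylinder _ _).1 AF setT filterT.
  exact: (@globally_properfilter _ _ (a, z)).
set K := filter_image _ _; have PK : ProperFilter K by exact: filter_image_proper.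
split=> // H LH; have PH := in_class_proper LH.
have FH : Filter H by exact: filter_filter.
have [z0 _] := filter_ex (@filterT _ H FH).
pose N : set_system (cone FH) := nbhs ((true, z0) : cone FH).
have PN : ProperFilter N by exact: cone_nbhs_filter.
pose A1 := [set p : X * cone FH | p.2.1 = false /\ A (p.1, p.2.2)].
pose E : set (cone FH) := [set p | p.1 = false].
have PE : ProperFilter (globally E) by exact: (@globally_properfilter _ _ (false, z0)).
have Pf := globally_set_proper false.
have A1F : globally A1 `#` cylinder (cone FH) (nbhs x).
  apply/globally_meets_cylinder => P FP.
  have [z [a Pa Aaz]] := (globally_meets_cylinder _ _).1 AF P FP.
  by exists (false, z), a.
have A1K : filter_image (globally A1) (nbhs x) =
           filter_prod (globally [set false]) K.
  rewrite /K !filter_image_globallyE eqEsubset; split=> S.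
    move=> [P FP PS]; exists ([set false], rel_image A P); first by split=> //; exists P.
    by move=> [b z] [/= -> [a Pa Aaz]]; apply: PS; exists a.
  move=> [[T Q] [/= fT [P FP PQ]] TQS]; exists P => //.
  move=> [b z] [a Pa [/= -> Aaz]]; apply: TQS; split; first exact: fT.
  by apply: PQ; exists a.
have NE : N `#` globally E.
  move=> B C [Bz /(_ isT) HB] EC; have [z Bfz] := filter_ex HB.
  by exists (false, z); split=> //; exact: EC.
have NEH : filter_join N (globally E) = filter_prod (globally [set false]) H.
  rewrite eqEsubset; split=> S.
    move=> [[B C] [/= [Bz /(_ isT) HB] EC] BCS].
    exists ([set false], [set z | B (false, z)]); first by split.
    by move=> [b z] [/= -> Bfz]; apply: BCS; split=> //; exact: EC.
  move=> [[T Q] [/= fT HQ] TQS].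
  exists ([set p | p.1 = true \/ Q p.2], E).
    split=> //; split; first by left.
    by move=> _; apply: filterS HQ => z Qz; right.
  move=> [b z] [/= [->//|Qz] bf]; apply: TQS; split=> //=.
  by rewrite [b]bf; exact: fT.
have KE : filter_join (filter_prod (globally [set false]) K) (globally E) =
          filter_prod (globally [set false]) K.
  have PfK := @filter_prod_proper _ _ _ _ Pf PK.
  rewrite eqEsubset; split=> S.
    move=> [[B C] [/= fB EC] BCS].
    apply: filterS BCS _; apply: filterI => //.
    exists ([set false], setT); first by split=> //; exact: filterT.
    by move=> [b z] [/= -> _]; exact: EC.
  by move=> fS; exists (S, E); [split | move=> p []].
have sNK : star (cone FH) N (filter_prod (globally [set false]) K).
  have [z1 [a1 _ A1az]] := (globally_meets_cylinder _ _).1 A1F setT filterT.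
  rewrite -A1K; apply: starP => //.
  - exact: (@globally_properfilter _ _ (a1, z1)).
  - have [_] := bXY _ (based_cone (FH := FH) cL pL LH) (x, (true, z0)).
    by apply; exists A1 => //; exists (a1, z1).
apply: starC => //; apply: (@star_slice star bool Z false) => //.
rewrite -NEH; apply: join_exchange => //.
by rewrite KE.
Qed.

Theorem corollary30 (J : class_of_filters) (star square nabla : filter_relation)
    (X : topologicalType) :
  steady J -> composable1 J -> class_sub principal_class J ->
  prod_compatible star -> prod_compatible square -> prod_compatible nabla ->
  [/\ [<-> based (ker (polar J star)) X;
           forall Y : topologicalType,
             based (ker (polar (polar J star) star)) Y ->
             based (ker (polar J star)) (X * Y)%type;
           forall Y : topologicalType, based J Y ->
             based (polar J star) (X * Y)%type;
           forall Y : topologicalType, based J Y ->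
             based (polar principal_class star) (X * Y)%type],
      composable1 (polar J star) -> class_sub principal_class (polar J star) ->
      [<-> based (ker (polar (polar J star) square)) X;
           forall Y : topologicalType, based (polar J star) Y ->
             based (ker (polar (ker (polar (polar J star) star)) square))
               (X * Y)%type;
           forall Y : topologicalType, based (polar J star) Y ->
             based (polar J square) (X * Y)%type;
           forall Y : topologicalType, based (polar J star) Y ->
             based (polar principal_class square) (X * Y)%type]
    & composable1 (polar J star) -> class_sub principal_class (polar J star) ->
      based (ker (polar (polar J nabla) square)) X ->
      forall Y : topologicalType,
        based (ker (polar (polar J star) nabla)) Y ->
        based (ker (polar (polar J star) square)) (X * Y)%type].
Proof.
move=> stJ cJ pJ pstar psquare pnabla.
have sJ := pstar.1; have nJ := pnabla.1.
split.
- split; [|split; [|split]].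
  + move=> bX Y; apply: based_prod bX => F G.
    exact: ker_polar_prod_bipolar.
  + move=> bXY Y bY; apply: based_sub (@ker_sub _) _; apply: bXY.
    by apply: based_sub bY; exact: sub_ker_bipolar.
  + by move=> bXY Y bY; apply: based_sub (bXY _ bY); exact: polar_sub.
  + exact: based_ker_polar_of_prod.
- move=> cJs pJs; split; [|split; [|split]].
  + move=> bX Y; apply: based_prod bX => F G kF JsG.
    apply: ker_polar_prod kF _ _ => //; first exact: in_class_proper JsG.
    move=> Z H kH; apply: ker_sub; apply: ker_polar_prod_bipolar => //.
    exact: composable1_sub_ker.
  + move=> bXY Y bY; apply: based_sub (bXY _ bY) => Z F /ker_sub.
    by apply: polar_sub; exact: sub_ker_bipolar.
  + by move=> bXY Y bY; apply: based_sub (bXY _ bY); exact: polar_sub.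
  + exact: based_ker_polar_of_prod.
- move=> cJs pJs bX Y; apply: based_prod bX => F G kF kG.
  apply: ker_polar_prod kF _ _ => //; first exact: in_class_proper kG.
  by move=> Z H JsH; exact: (polar_prod_polar stJ cJs).
Qed.
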